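(* Let $C\ge2$, $d\ge1$ be integers, $\eta>0$, and $\beta_C=\min\{\tfrac12,\tfrac1{\log C}\}$. Let $\mathcal B$ be a nonempty finite minibatch of examples $i$, each with an observed label $\widetilde y_i\in\{1,\ldots,C\}$ and a nonzero feature vector $\bm h_i\in\mathbb R^d$; let $W\in\mathbb R^{C\times d}$ have nonzero rows $\bm w_1,\ldots,\bm w_C$, let $\bm b\in\mathbb R^C$, and let $\widehat{\bm\pi}$ be a probability vector on $\{1,\ldots,C\}$ with all $\widehat\pi_c>0$. With $\mathcal L_{\mathrm{comp}}$, $\mathcal L_{\mathrm{sep}}$ and $\mathcal L_{\mathrm{BARGE}}$ the compactness term, separation term and total objective defined in the context, $$0\le\mathcal L_{\mathrm{comp}}\le2,\qquad 0\le\mathcal L_{\mathrm{sep}}\le1,$$ and therefore $$0\le\mathcal L_{\mathrm{BARGE}}\le\frac{1+\beta_C}{\beta_C}+3\eta.$$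
   Context: Logits: $\bm z_i=W\bm h_i+\bm b\in\mathbb R^C$. Prior-adjusted probabilities: $$r_{ic}=\frac{\widehat\pi_c e^{z_{ic}}}{\sum_{k=1}^C\widehat\pi_k e^{z_{ik}}}.$$ Classification term: with $\ell_\beta(\bm r,y)=\frac1\beta+\sum_{c=1}^C r_c^{1+\beta}-\frac{1+\beta}{\beta}r_y^\beta$ for a probability vector $\bm r$ and label $y$, $$\mathcal L_{\mathrm{cls}}=\frac1{|\mathcal B|}\sum_{i\in\mathcal B}\ell_{\beta_C}(\bm r_i,\widetilde y_i).$$ Normalized vectors: $\widehat{\bm h}_i=\bm h_i/\|\bm h_i\|_2$ and $\widehat{\bm w}_c=\bm w_c/\|\bm w_c\|_2$. Reliability weights: $\omega_i=r_{i\widetilde y_i}^{\beta_C}\in(0,1]$ (in training these are treated as constants under differentiation, which does not affect their values). Compactness term: with $\mathcal B_c=\{i\in\mathcal B:\widetilde y_i=c\}$ and $\mathcal C_{\mathcal B}=\{c:|\mathcal B_c|>0\}$, $$\mathcal L_{\mathrm{comp}}=\frac1{|\mathcal C_{\mathcal B}|}\sum_{c\in\mathcal C_{\mathcal B}}\frac{\sum_{i\in\mathcal B_c}\omega_i\bigl(1-\widehat{\bm h}_i^\top\widehat{\bm w}_c\bigr)}{\sum_{i\in\mathcal B_c}\omega_i}.$$ Separation term: $$\mathcal L_{\mathrm{sep}}=\frac1{C(C-1)}\sum_{\substack{c,k=1\\ c\ne k}}^C\bigl[\max(0,\widehat{\bm w}_c^\top\widehat{\bm w}_k)\bigr]^2.$$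 Total objective: $\mathcal L_{\mathrm{BARGE}}=\mathcal L_{\mathrm{cls}}+\eta(\mathcal L_{\mathrm{comp}}+\mathcal L_{\mathrm{sep}})$. *)

(* Defs.v *)
From HB Require Import structures.
From mathcomp Require Import all_boot all_order all_algebra.
From mathcomp Require Import reals sequences exp.

Set Implicit Arguments.
Unset Strict Implicit.
Unset Printing Implicit Defensive.
Import Order.TTheory GRing.Theory Num.Theory.
Local Open Scope ring_scope.

Section Euclidean.
Variables (R : realType) (d : nat).
Implicit Types u v : 'cV[R]_d.

Definition dot u v : R := (u^T *m v) 0 0.

(* The norm `|v| that the library puts on matrices is the sup norm, hence this
   separate Euclidean norm. *)
Definition norm2 v : R := Num.sqrt (dot v v).

Definition normalize v : 'cV[R]_d := (norm2 v)^-1 *: v.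

End Euclidean.

Section Losses.
Variable R : realType.

Definition betaC (C : nat) : R := Num.min 2^-1 (ln C%:R)^-1.

Definition prob_vector (C : nat) (p : 'I_C -> R) : Prop :=
  (forall c, 0 <= p c) /\ \sum_c p c = 1.

Definition ell (C : nat) (beta : R) (r : 'I_C -> R) (y : 'I_C) : R :=
  beta^-1 + (\sum_c r c `^ (1 + beta)) - (1 + beta) / beta * r y `^ beta.

Variables (C d : nat) (I : finType).
(* A minibatch is a set B of examples i : I; y i is the observed label of i, h i
   its feature vector, and prior the vector of estimated class priors. *)
Variables (B : {set I}) (y : I -> 'I_C) (h : I -> 'cV[R]_d).
Variables (W : 'M[R]_(C, d)) (b : 'cV[R]_C) (prior : 'I_C -> R).

Definition logits (i : I) : 'cV[R]_C := W *m h i + b.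

Definition adj_prob (i : I) (c : 'I_C) : R :=
  prior c * expR (logits i c 0) / (\sum_k prior k * expR (logits i k 0)).

Definition L_cls : R :=
  #|B|%:R^-1 * \sum_(i in B) ell (betaC C) (adj_prob i) (y i).

Definition hhat (i : I) : 'cV[R]_d := normalize (h i).

Definition what (c : 'I_C) : 'cV[R]_d := normalize (row c W)^T.

Definition omega (i : I) : R := adj_prob i (y i) `^ betaC C.

Definition batch_class (c : 'I_C) : {set I} := [set i in B | y i == c].

Definition present_classes : {set 'I_C} :=
  [set c | (0 < #|batch_class c|)%N].

Definition L_comp : R :=
  #|present_classes|%:R^-1 *
  \sum_(c in present_classes)
    ((\sum_(i in batch_class c) omega i * (1 - dot (hhat i) (what c)))
     / (\sum_(i in batch_class c) omega i)).

Definition L_sep : R :=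
  (C%:R * (C%:R - 1))^-1 *
  \sum_c \sum_(k | c != k) (Num.max 0 (dot (what c) (what k))) ^+ 2.

Definition L_BARGE (eta : R) : R := L_cls + eta * (L_comp + L_sep).

End Losses.

(* Main.v *)
(** Each class term of the compactness loss is a weighted mean of quantities
    [1 - cos], hence lies in [[0, 2]], and so does the mean over the classes;
    the separation loss is a mean of [C (C - 1)] squared positive parts of
    cosines. For the classification loss, nonnegativity of [ell] is Young's
    inequality [(1 + beta) r^beta <= beta r^(1 + beta) + 1] at [r = r_y], and
    the upper bound [1 / beta + 1] follows from [r_c^(1 + beta) <= r_c] and
    [sum_c r_c = 1]. *)
Require Import Defs.
From HB Require Import structures.
From mathcomp Require Import all_boot all_order all_algebra.
From mathcomp Require Import reals sequences exp.
From mathcomp Require Import ring lra.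

Set Implicit Arguments.
Unset Strict Implicit.
Unset Printing Implicit Defensive.
Import Order.TTheory GRing.Theory Num.Theory.
Local Open Scope ring_scope.

(** Weights are only nonnegative, so the total may vanish; the quotient is then 0 by the convention
    [0^-1 = 0], and [0 <= M] keeps it in range. *)
Lemma weighted_mean_bounds (R : realType) (I : finType) (A : {set I})
    (w f : I -> R) (M : R) :
  0 <= M -> (forall i, i \in A -> 0 <= w i) ->
  (forall i, i \in A -> 0 <= f i <= M) ->
  0 <= (\sum_(i in A) w i * f i) / (\sum_(i in A) w i) <= M.
Proof.
move=> M0 w0 fM.
have sw0 : 0 <= \sum_(i in A) w i by apply: sumr_ge0.
apply/andP; split.
  apply: divr_ge0 => //; apply: sumr_ge0 => i iA.
  by rewrite mulr_ge0 ?w0//; case/andP: (fM i iA).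
have [->|swN0] := eqVneq (\sum_(i in A) w i) 0; first by rewrite invr0 mulr0.
rewrite ler_pdivrMr ?lt0r ?swN0// mulr_sumr; apply: ler_sum => i iA.
by rewrite mulrC ler_wpM2r ?w0//; case/andP: (fM i iA).
Qed.

(** The case of unit weights, whose total is [#|A|]. *)
Lemma mean_bounds (R : realType) (I : finType) (A : {set I}) (f : I -> R)
    (M : R) :
  0 <= M -> (forall i, i \in A -> 0 <= f i <= M) ->
  0 <= #|A|%:R^-1 * (\sum_(i in A) f i) <= M.
Proof.
move=> M0 fM.
have := @weighted_mean_bounds R I A (fun=> 1) f M M0 (fun _ _ => ler01) fM.
by rewrite sumr_const mulrC; under eq_bigr do rewrite mul1r.
Qed.

Section Cosines.
Variables (R : realType) (d : nat).
Implicit Types u v : 'cV[R]_d.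

Lemma dotE u v : dot u v = \sum_i u i 0 * v i 0.
Proof. by rewrite /dot mxE; apply: eq_bigr => i _; rewrite mxE. Qed.

Lemma dot_ge0 u : 0 <= dot u u.
Proof. by rewrite dotE sumr_ge0// => i _; rewrite -expr2 sqr_ge0. Qed.

Lemma dot_gt0 u : u != 0 -> 0 < dot u u.
Proof.
move=> uN0; rewrite lt0r dot_ge0 andbT; apply: contra uN0 => /eqP.
rewrite dotE => /eqP; rewrite psumr_eq0; last first.
  by move=> i _; rewrite -expr2 sqr_ge0.
move=> /allP u0; apply/eqP/matrixP => i j; rewrite ord1 mxE; apply/eqP.
by have := u0 i (mem_index_enum i); rewrite -expr2 sqrf_eq0.
Qed.

Lemma dot_normalize u : u != 0 -> dot (normalize u) (normalize u) = 1.
Proof.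
move=> /dot_gt0 u0; set a := (norm2 u)^-1.
have -> : dot (normalize u) (normalize u) = a ^+ 2 * dot u u.
  rewrite !dotE mulr_sumr; apply: eq_bigr => i _.
  by rewrite /normalize -/a !mxE; ring.
by rewrite exprVn sqr_sqrtr ?ltW// mulVf ?gt_eqF.
Qed.

(** Cauchy-Schwarz for unit vectors: the squared norms of [u - v] and [u + v] expand to
    [2 - 2 * dot u v] and [2 + 2 * dot u v], and both are nonnegative. *)
Lemma unit_dot_bounds u v : dot u u = 1 -> dot v v = 1 -> -1 <= dot u v <= 1.
Proof.
move=> u1 v1; have := dot_ge0 (u + v); have := dot_ge0 (u - v).
have -> : dot (u - v) (u - v) = dot u u - 2 * dot u v + dot v v.
  rewrite !dotE mulr_sumr -sumrB -big_split/=.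
  by apply: eq_bigr => i _; rewrite !mxE; ring.
have -> : dot (u + v) (u + v) = dot u u + 2 * dot u v + dot v v.
  rewrite !dotE mulr_sumr -!big_split/=.
  by apply: eq_bigr => i _; rewrite !mxE; ring.
rewrite u1 v1 => ? ?; apply/andP; split; lra.
Qed.

Lemma normalize_dot_bounds u v : u != 0 -> v != 0 ->
  -1 <= dot (normalize u) (normalize v) <= 1.
Proof. by move=> /dot_normalize u1 /dot_normalize; exact: unit_dot_bounds. Qed.

End Cosines.

Lemma betaC_gt0 (R : realType) (C : nat) : (2 <= C)%N -> 0 < betaC R C.
Proof.
move=> C2; rewrite /betaC lt_min !invr_gt0 ltr0n/=.
by rewrite ln_gt0// ltr1n.
Qed.

Lemma prob_vector_le1 (R : realType) (C : nat) (p : 'I_C -> R) (c : 'I_C) :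
  prob_vector p -> p c <= 1.
Proof.
move=> [p0 <-]; rewrite (bigD1 c)//= lerDl.
by apply: sumr_ge0.
Qed.

Lemma ell_bounds (R : realType) (C : nat) (beta : R) (r : 'I_C -> R)
    (c : 'I_C) :
  0 < beta -> prob_vector r -> 0 <= ell beta r c <= (1 + beta) / beta.
Proof.
move=> beta0 pr; have [r0 r1] := pr.
have beta1 : 0 < 1 + beta by rewrite addr_gt0.
rewrite /ell; apply/andP; split.
  have young : r c `^ beta <= r c `^ (1 + beta) / ((1 + beta) / beta)
      + (1 + beta)^-1.
    have := @conjugate_powR R (r c `^ beta) 1 ((1 + beta) / beta) (1 + beta).
    rewrite powR1 mulr1 div1r -powRrM.
    have -> : beta * ((1 + beta) / beta) = 1 + beta by field; rewrite gt_eqF.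
    apply; rewrite ?powR_ge0 ?divr_gt0//.
    by field; rewrite !gt_eqF.
  have le_sum : r c `^ (1 + beta) <= \sum_k r k `^ (1 + beta).
    by rewrite (bigD1 c)//= lerDl sumr_ge0// => k _; rewrite powR_ge0.
  have k0 : 0 < (1 + beta) / beta by rewrite divr_gt0.
  move: young; rewrite -(ler_pM2l k0) mulrDr mulrCA divff ?gt_eqF// mulr1.
  have -> : (1 + beta) / beta * (1 + beta)^-1 = beta^-1.
    by field; rewrite !gt_eqF.
  lra.
have le1 : \sum_k r k `^ (1 + beta) <= 1.
  rewrite -[leRHS]r1; apply: ler_sum => k _.
  (* Antitonicity of the power in its exponent is applied to a base in (0, 1], so a zero entry is
     treated apart. *)
  have [->|rkN0] := eqVneq (r k) 0; first by rewrite powR0 ?gt_eqF.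
  rewrite -[leRHS]powRr1//; apply: ger_powR; last by rewrite lerDl ltW.
  by rewrite lt0r rkN0 r0 prob_vector_le1.
have : 0 <= (1 + beta) / beta * r c `^ beta.
  by rewrite mulr_ge0 ?powR_ge0 ?divr_ge0 ?ltW.
have -> : (1 + beta) / beta = beta^-1 + 1 by field; rewrite gt_eqF.
lra.
Qed.

Lemma adj_prob_prob_vector (R : realType) (C d : nat) (I : finType)
    (h : I -> 'cV[R]_d) (W : 'M[R]_(C, d)) (b : 'cV[R]_C) (prior : 'I_C -> R)
    (i : I) :
  (0 < C)%N -> (forall c, 0 < prior c) -> prob_vector (adj_prob h W b prior i).
Proof.
move=> C0 prior_gt0.
set s := \sum_k prior k * expR (logits h W b i k 0).
have term_gt0 k : 0 < prior k * expR (logits h W b i k 0).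
  by rewrite mulr_gt0 ?expR_gt0.
have s0 : 0 < s.
  (* Strict positivity of the normalizer requires at least one class; class 0 is isolated as the
     witness. *)
  rewrite /s (bigD1 (Ordinal C0))//= ltr_wpDr// sumr_ge0// => k _.
  exact: ltW.
split=> [c|]; first by rewrite /adj_prob divr_ge0// ltW.
by rewrite /adj_prob -mulr_suml divff// gt_eqF.
Qed.

Lemma L_cls_bounds (R : realType) (C d : nat) (I : finType) (B : {set I})
    (y : I -> 'I_C) (h : I -> 'cV[R]_d) (W : 'M[R]_(C, d)) (b : 'cV[R]_C)
    (prior : 'I_C -> R) :
  (2 <= C)%N -> (forall c, 0 < prior c) ->
  0 <= L_cls B y h W b prior <= (1 + betaC R C) / betaC R C.
Proof.
move=> C2 prior_gt0; have beta0 := betaC_gt0 R C2.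
apply: mean_bounds => [|i _]; first by rewrite divr_ge0 ?addr_ge0// ltW.
by apply: ell_bounds => //; apply: adj_prob_prob_vector => //; exact: ltnW.
Qed.

Lemma L_comp_bounds (R : realType) (C d : nat) (I : finType) (B : {set I})
    (y : I -> 'I_C) (h : I -> 'cV[R]_d) (W : 'M[R]_(C, d)) (b : 'cV[R]_C)
    (prior : 'I_C -> R) :
  (forall i, i \in B -> h i != 0) -> (forall c, row c W != 0) ->
  0 <= L_comp B y h W b prior <= 2.
Proof.
move=> hN0 WN0; apply: mean_bounds => [|c _]; first exact: ler0n.
(* The weights [omega] are nonnegative as real powers; what remains is to place [1 - cos] in [0, 2]
   for each example of the class. *)
apply: weighted_mean_bounds => [|i _|i]; rewrite ?ler0n ?powR_ge0//.
rewrite inE => /andP[iB _].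
have /andP[] : -1 <= dot (hhat h i) (what W c) <= 1.
  by apply: normalize_dot_bounds; rewrite ?hN0 ?trmx_eq0.
by move=> ? ?; apply/andP; split; lra.
Qed.

Lemma L_sep_bounds (R : realType) (C d : nat) (W : 'M[R]_(C, d)) :
  (2 <= C)%N -> (forall c, row c W != 0) -> 0 <= L_sep W <= 1.
Proof.
move=> C2 WN0.
have C1 : 0 < C%:R - 1 :> R by rewrite subr_gt0 ltr1n.
have CC0 : 0 < C%:R * (C%:R - 1) :> R by rewrite mulr_gt0// ltr0n ltnW.
have term_le1 c k : Num.max 0 (dot (what W c) (what W k)) ^+ 2 <= 1.
  have /andP[_ le1] : -1 <= dot (what W c) (what W k) <= 1.
    by apply: normalize_dot_bounds; rewrite trmx_eq0.
  by rewrite expr_le1 ?le_max ?lexx// ge_max ler01.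
rewrite /L_sep mulrC; apply/andP; split.
  rewrite divr_ge0 ?(ltW CC0)// sumr_ge0// => c _.
  by rewrite sumr_ge0// => k _; rewrite sqr_ge0.
rewrite ler_pdivrMr// mul1r.
(* The normalizing constant [C (C - 1)] is rewritten as a sum of ones over the off-diagonal pairs,
   so that the bound reduces to a termwise comparison. *)
have off_diag c : \sum_(k < C | c != k) 1 = C%:R - 1 :> R.
  have -> : C%:R = \sum_(k < C) 1 :> R by rewrite sumr_const card_ord.
  rewrite [in RHS](bigD1 c)//= addrAC subrr add0r.
  by apply: eq_bigl => k; rewrite eq_sym.
have -> : C%:R * (C%:R - 1) = \sum_(c < C) \sum_(k < C | c != k) 1 :> R.
  by under eq_bigr do rewrite off_diag; rewrite sumr_const card_ord mulr_natl.
by apply: ler_sum => c _; apply: ler_sum => k _.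
Qed.

Theorem proposition3 (R : realType) (C d : nat) (eta : R) (I : finType)
    (B : {set I}) (y : I -> 'I_C) (h : I -> 'cV[R]_d)
    (W : 'M[R]_(C, d)) (b : 'cV[R]_C) (prior : 'I_C -> R)
    (hC : (2 <= C)%N) (hd : (1 <= d)%N) (heta : 0 < eta)
    (hB : B != set0)
    (hh : forall i, i \in B -> h i != 0)
    (hW : forall c, row c W != 0)
    (hprior : prob_vector prior) (hprior_gt0 : forall c, 0 < prior c) :
  [/\ 0 <= L_comp B y h W b prior <= 2,
      0 <= L_sep W <= 1 &
      0 <= L_BARGE B y h W b prior eta <=
        (1 + betaC R C) / betaC R C + 3 * eta].
Proof.
have comp := L_comp_bounds y b prior hh hW.
have sep := L_sep_bounds hC hW.
split=> //.
have /andP[cls0 clsM] := L_cls_bounds B y h W b hC hprior_gt0.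
case/andP: comp => comp0 comp2; case/andP: sep => sep0 sep1.
rewrite /L_BARGE; apply/andP; split.
  by rewrite addr_ge0// mulr_ge0 ?addr_ge0// ltW.
(* The constant 3 adds the compactness bound 2 and the separation bound 1. *)
rewrite lerD// mulrC ler_wpM2r ?(ltW heta)//.
lra.
Qed.
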